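(* Let $\mathbf{G}$ be a categorical group, let $\mathbf{V}_1$ and $\mathbf{V}_2$ be vector categories, and let $(\eta_1,\rho_1,\mathbf{V}_1)$ and $(\eta_2,\rho_2,\mathbf{V}_2)$ be irreducible twisted representations of $\mathbf{G}$ on $\mathbf{V}_1$ and $\mathbf{V}_2$, respectively. Let $\mathbf{F}:(\eta_1,\rho_1,\mathbf{V}_1)\to(\eta_2,\rho_2,\mathbf{V}_2)$ be a morphism of representations, given by a linear functor $\mathbf{F}:\mathbf{V}_1\to\mathbf{V}_2$. Then one of the following holds: (1) $\mathbf{F}$ is a zero functor; or (2) there is a well-defined quotient category $\mathbf{V}_1/\mathbf{O}_{\mathbf{V}_1}$, and $\mathbf{F}$ induces a functor $\mathbf{V}_1/\mathbf{O}_{\mathbf{V}_1}\to\mathbf{V}_2$ that is an isomorphism both on objects and on morphisms; or (3) $\mathbf{F}$ is an isomorphism.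
   Context: For a category, $s$ and $t$ denote the source and target maps on morphisms, $1_x$ is the identity morphism at $x$, and $g\circ f$ is defined when $s(g)=t(f)$. A categorical group $\mathbf{G}$ is a category with a bifunctor $\otimes:\mathbf{G}\times\mathbf{G}\to\mathbf{G}$ (written as juxtaposition) such that $\mathrm{Obj}(\mathbf{G})$ and $\mathrm{Mor}(\mathbf{G})$ are both groups under $\otimes$. The identity element of $\mathrm{Obj}(\mathbf{G})$ is $e$; $1_e$ is the identity element of the group $\mathrm{Mor}(\mathbf{G})$. An $\eta$-map for a category $\mathbf{V}$ is a map $\eta:\mathrm{Mor}(\mathbf{G})\times\mathrm{Mor}(\mathbf{V})\to\mathrm{Mor}(\mathbf{G})$ such that: (i) $\eta(k,f)$ has the same source and the same target as $k$; (ii) $\eta(k,f_2\circ f_1)=\eta(\eta(k,f_2),f_1)$ for composable $f_2,f_1$, and $\eta(k,1_b)=k$; (iii) $\eta(k_2\circ k_1,f)=\eta(k_2,f)\circ\eta(k_1,f)$ for composable $k_2,k_1$, and $\eta(1_a,f)=1_a$; (iv) $\eta(k1_a,f)=\eta(k,f)1_a$ and $\eta(1_ck,f)=1_c\,\eta(k,f)$ for all $k\in\mathrm{Mor}(\mathbf{G})$, $a,c\in\mathrm{Obj}(\mathbf{G})$, $f\in\mathrm{Mor}(\mathbf{V})$. The semidirect product category $\mathbf{G}\rtimes_\eta\mathbf{V}$ has objects $\mathrm{Obj}(\mathbf{G})\times\mathrm{Obj}(\mathbf{V})$, morphisms $\mathrm{Mor}(\mathbf{G})\times\mathrm{Mor}(\mathbf{V})$,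 componentwise source and target, and composition $(k_2,f_2)\circ_\eta(k_1,f_1)=(\eta(k_2,f_1)\circ k_1,\,f_2\circ f_1)$. An $\eta$-twisted action of $\mathbf{G}$ on $\mathbf{V}$ is a functor $\rho:\mathbf{G}\rtimes_\eta\mathbf{V}\to\mathbf{V}$ with $\rho(1_e,f)=f$ and $\rho(k_2,\rho(k_1,f))=\rho(k_2k_1,f)$ for all $k_1,k_2\in\mathrm{Mor}(\mathbf{G})$, $f\in\mathrm{Mor}(\mathbf{V})$. A vector category is a category whose object and morphism sets are equipped with vector space structures (over a fixed field) such that the source map, the target map and the identity-assigning map $x\mapsto 1_x$ are linear. A twisted representation $(\eta,\rho,\mathbf{V})$ of $\mathbf{G}$ on a vector category $\mathbf{V}$ is an $\eta$-twisted action $\rho$ of $\mathbf{G}$ on $\mathbf{V}$ such that $v\mapsto\rho(g,v)$ on $\mathrm{Obj}(\mathbf{V})$ and $f\mapsto\rho(k,f)$ on $\mathrm{Mor}(\mathbf{V})$ are linear for every $g\in\mathrm{Obj}(\mathbf{G})$ and $k\in\mathrm{Mor}(\mathbf{G})$. A morphism $\mathbf{F}:(\eta_1,\rho_1,\mathbf{V}_1)\to(\eta_2,\rho_2,\mathbf{V}_2)$ is a functor $\mathbf{F}:\mathbf{V}_1\to\mathbf{V}_2$ such that $\eta_2(k,\mathbf{F}(f))=\eta_1(k,f)$ for all $k\in\mathrm{Mor}(\mathbf{G})$, $f\in\mathrm{Mor}(\mathbf{V}_1)$, and $\mathbf{F}\circ\rho_1=\rho_2\circ(\mathrm{Id}_{\mathbf{G}}\times\mathbf{F})$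 as functors $\mathbf{G}\rtimes_{\eta_1}\mathbf{V}_1\to\mathbf{V}_2$. For a vector category $\mathbf{V}$, the trivial subcategory $\mathbf{O}_{\mathbf{V}}$ has the single object $0$ and morphism set $\mathrm{Hom}(0,0)$; $\mathbf{O}$ denotes the subcategory with only the object $0$ and its identity morphism. A vector subcategory is a subcategory whose object and morphism sets are linear subspaces; it is proper if it is different from $\mathbf{V}$, $\mathbf{O}_{\mathbf{V}}$ and $\mathbf{O}$. A twisted representation $(\eta,\rho,\mathbf{V})$ is reducible if there is a proper vector subcategory $\mathbf{U}$ of $\mathbf{V}$ such that the restriction of $(\eta,\rho)$ to $\mathbf{U}$ defines a representation of $\mathbf{G}$ on $\mathbf{U}$ (i.e. $\rho$ restricts to a functor $\mathbf{G}\rtimes_{\eta|_{\mathbf{U}}}\mathbf{U}\to\mathbf{U}$, with $\eta|_{\mathbf{U}}$ the restriction of $\eta$ to $\mathrm{Mor}(\mathbf{G})\times\mathrm{Mor}(\mathbf{U})$); it is irreducible if it is not reducible. A functor between vector categories is linear if it induces linear maps on object spaces and on morphism spaces. A functor $\mathbf{F}:\mathbf{V}\to\mathbf{W}$ of vector categories is a zero functor if its image is contained in $\mathbf{O}_{\mathbf{W}}$. The quotient category $\mathbf{V}_1/\mathbf{O}_{\mathbf{V}_1}$ is the vector category whose object and morphism spaces are the quotient spaces $\mathrm{Obj}(\mathbf{V}_1)/\{0\}=\mathrm{Obj}(\mathbf{V}_1)$ and $\mathrm{Mor}(\mathbf{V}_1)/\mathrm{Hom}(0,0)$, with source, target and composition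 induced from $\mathbf{V}_1$; it is well-defined when these operations descend to the quotient spaces. The functor induced by $\mathbf{F}$ is $v\mapsto\mathbf{F}(v)$ on objects and $f+\mathrm{Hom}(0,0)\mapsto\mathbf{F}(f)$ on morphisms. *)

(* Defs.v *)
From HB Require Import structures.
From mathcomp Require Import all_boot all_algebra.
From mathcomp Require Import boolp classical_sets.

Set Implicit Arguments.
Unset Strict Implicit.
Unset Printing Implicit Defensive.

Import GRing.Theory.
Local Open Scope ring_scope.
Local Open Scope quotient_scope.

(* Composition is a total function, but every law and every later condition
   mentions [c g f] only when [s g = t f]; on other pairs it is junk. *)
Record category_laws (O M : Type) (s t : M -> O) (i : O -> M)
    (c : M -> M -> M) : Prop := CategoryLaws {
  law_src_id : forall x, s (i x) = x;
  law_tgt_id : forall x, t (i x) = x;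
  law_src_comp : forall g f, s g = t f -> s (c g f) = s f;
  law_tgt_comp : forall g f, s g = t f -> t (c g f) = t g;
  law_compA : forall h g f, s h = t g -> s g = t f ->
    c h (c g f) = c (c h g) f;
  law_comp_idl : forall f, c (i (t f)) f = f;
  law_comp_idr : forall f, c f (i (s f)) = f
}.

Record category := Category {
  Ob : Type;
  Mor : Type;
  src : Mor -> Ob;
  tgt : Mor -> Ob;
  idm : Ob -> Mor;
  comp : Mor -> Mor -> Mor;
  categoryP : category_laws src tgt idm comp
}.

Arguments src {c}.
Arguments tgt {c}.
Arguments idm {c}.
Arguments comp {c}.

Notation "g \oc f" := (comp g f) (at level 50, left associativity).

Record functor (C D : category) := Functor {
  fob : Ob C -> Ob D;
  fmor : Mor C -> Mor D;
  functor_src : forall f, src (fmor f) = fob (src f);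
  functor_tgt : forall f, tgt (fmor f) = fob (tgt f);
  functor_id : forall x, fmor (idm x) = idm (fob x);
  functor_comp : forall g f, src g = tgt f -> fmor (g \oc f) = fmor g \oc fmor f
}.

(* [gsrcM] to [gcompM] say that the two group multiplications form a
   bifunctor. *)
Record categorical_group := CategoricalGroup {
  gOb : groupType;
  gMor : groupType;
  gsrc : gMor -> gOb;
  gtgt : gMor -> gOb;
  gid : gOb -> gMor;
  gcomp : gMor -> gMor -> gMor;
  gsrcM : forall k2 k1, gsrc (k2 * k1)%g = (gsrc k2 * gsrc k1)%g;
  gtgtM : forall k2 k1, gtgt (k2 * k1)%g = (gtgt k2 * gtgt k1)%g;
  gidM : forall b a, gid (b * a)%g = (gid b * gid a)%g;
  gcompM : forall k2' k1' k2 k1, gsrc k2' = gtgt k1' -> gsrc k2 = gtgt k1 ->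
    gcomp (k2' * k2)%g (k1' * k1)%g = (gcomp k2' k1' * gcomp k2 k1)%g;
  gcatP : category_laws gsrc gtgt gid gcomp
}.

Coercion gcat (G : categorical_group) : category := Category (gcatP G).

Record eta_map (G : categorical_group) (V : category) := EtaMap {
  eta :> gMor G -> Mor V -> gMor G;
  eta_src : forall k f, gsrc (eta k f) = gsrc k;
  eta_tgt : forall k f, gtgt (eta k f) = gtgt k;
  eta_compr : forall k f2 f1, src f2 = tgt f1 ->
    eta k (f2 \oc f1) = eta (eta k f2) f1;
  eta_idr : forall k b, eta k (idm b) = k;
  eta_compl : forall k2 k1 f, gsrc k2 = gtgt k1 ->
    eta (gcomp k2 k1) f = gcomp (eta k2 f) (eta k1 f);
  eta_idl : forall a f, eta (gid a) f = gid a;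
  eta_mulr : forall k a f, eta (k * gid a)%g f = (eta k f * gid a)%g;
  eta_mull : forall c k f, eta (gid c * k)%g f = (gid c * eta k f)%g
}.

Section Semidirect.
Variables (G : categorical_group) (V : category) (eta : eta_map G V).

Definition sd_src (p : gMor G * Mor V) := (gsrc p.1, src p.2).
Definition sd_tgt (p : gMor G * Mor V) := (gtgt p.1, tgt p.2).
Definition sd_id (x : gOb G * Ob V) := (gid x.1, idm x.2).
Definition sd_comp (p2 p1 : gMor G * Mor V) :=
  (gcomp (eta p2.1 p1.2) p1.1, p2.2 \oc p1.2).

Lemma semidirectP : category_laws sd_src sd_tgt sd_id sd_comp.
Proof.
have [Gs Gt Gsc Gtc GA Gl Gr] := gcatP G.
have [Vs Vt Vsc Vtc VA Vl Vr] := categoryP V.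
split; rewrite /sd_src /sd_tgt /sd_id /sd_comp.
- by case=> a x /=; rewrite Gs Vs.
- by case=> a x /=; rewrite Gt Vt.
- by case=> [k2 f2] [k1 f1] /= [e1 e2]; rewrite Gsc ?Vsc // eta_src.
- by case=> [k2 f2] [k1 f1] /= [e1 e2]; rewrite Gtc ?Vtc ?eta_tgt // eta_src.
- case=> [k3 f3] [k2 f2] [k1 f1] /= [e1 e2] [e3 e4].
  rewrite VA // eta_compr // eta_compl ?eta_src // GA ?eta_src ?eta_tgt //.
- by case=> k f /=; rewrite eta_idl Gl Vl.
- by case=> k f /=; rewrite eta_idr Gr Vr.
Qed.

Definition semidirect : category := Category semidirectP.
End Semidirect.

Record vector_category (K : fieldType) := VectorCategory {
  vOb : lmodType K;
  vMor : lmodType K;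
  vsrc : {linear vMor -> vOb};
  vtgt : {linear vMor -> vOb};
  vid : {linear vOb -> vMor};
  vcomp : vMor -> vMor -> vMor;
  vcatP : category_laws vsrc vtgt vid vcomp
}.

Coercion vcat (K : fieldType) (V : vector_category K) : category :=
  Category (vcatP V).

Definition linear_functor (K : fieldType) (V W : vector_category K)
    (F : functor V W) : Prop :=
  linear (fob F : vOb V -> vOb W) /\ linear (fmor F : vMor V -> vMor W).

Record twisted_rep (K : fieldType) (G : categorical_group)
    (V : vector_category K) := TwistedRep {
  rep_eta : eta_map G V;
  rep_act : functor (semidirect rep_eta) V;
  rep_act1 : forall f : vMor V, fmor rep_act (gid 1%g, f) = f;
  rep_actM : forall (k2 k1 : gMor G) (f : vMor V),
    fmor rep_act (k2, fmor rep_act (k1, f)) = fmor rep_act ((k2 * k1)%g, f);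
  rep_act_obL : forall g : gOb G,
    linear ((fun v => fob rep_act (g, v)) : vOb V -> vOb V);
  rep_act_morL : forall k : gMor G,
    linear ((fun f => fmor rep_act (k, f)) : vMor V -> vMor V)
}.

(* The last two fields are the equality of functors
   F o rho_1 = rho_2 o (Id x F), on objects and on morphisms. *)
Record rep_morphism (K : fieldType) (G : categorical_group)
    (V1 V2 : vector_category K) (R1 : twisted_rep G V1) (R2 : twisted_rep G V2)
    (F : functor V1 V2) : Prop := RepMorphism {
  rep_morphism_eta : forall (k : gMor G) (f : vMor V1),
    rep_eta R2 k (fmor F f) = rep_eta R1 k f;
  rep_morphism_ob : forall (g : gOb G) (v : vOb V1),
    fob F (fob (rep_act R1) (g, v)) = fob (rep_act R2) (g, fob F v);
  rep_morphism_mor : forall (k : gMor G) (f : vMor V1),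
    fmor F (fmor (rep_act R1) (k, f)) = fmor (rep_act R2) (k, fmor F f)
}.

Definition rep_isomorphism (K : fieldType) (G : categorical_group)
    (V1 V2 : vector_category K) (R1 : twisted_rep G V1) (R2 : twisted_rep G V2)
    (F : functor V1 V2) : Prop :=
  [/\ rep_morphism R1 R2 F, linear_functor F
    & exists F' : functor V2 V1,
      [/\ rep_morphism R2 R1 F', linear_functor F',
          cancel (fob F) (fob F') /\ cancel (fob F') (fob F)
        & cancel (fmor F) (fmor F') /\ cancel (fmor F') (fmor F)]].

Section Hom00.
Variables (K : fieldType) (V : vector_category K).

Definition hom00 : {pred vMor V} :=
  [pred f | (vsrc V f == 0) && (vtgt V f == 0)].

Lemma hom00E f : (f \in hom00) = (vsrc V f == 0) && (vtgt V f == 0).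
Proof. by []. Qed.

Lemma hom00_zmod_closed : zmod_closed hom00.
Proof.
split=> [|f g]; rewrite !hom00E ?linear0 ?eqxx //.
by move=> /andP[/eqP f1 /eqP f2] /andP[/eqP g1 /eqP g2];
  rewrite !linearB f1 f2 g1 g2 subrr eqxx.
Qed.

HB.instance Definition _ := GRing.isZmodClosed.Build (vMor V) hom00
  hom00_zmod_closed.

Lemma hom00Z a f : f \in hom00 -> a *: f \in hom00.
Proof.
by rewrite !hom00E !linearZZ => /andP[/eqP -> /eqP ->]; rewrite scaler0 eqxx.
Qed.
End Hom00.

Arguments hom00 {K} V.

Section Subcategories.
Variables (K : fieldType) (V : vector_category K).

Record subdata := Subdata { sub_ob : set (vOb V); sub_mor : set (vMor V) }.

Definition sub_whole : subdata := Subdata setT setT.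
Definition sub_OV : subdata := Subdata [set 0] [set f | f \in hom00 V].
Definition sub_O : subdata := Subdata [set 0] [set vid V 0].

Record vector_subcategory (U : subdata) : Prop := VectorSubcategory {
  sub_src : forall f, sub_mor U f -> sub_ob U (vsrc V f);
  sub_tgt : forall f, sub_mor U f -> sub_ob U (vtgt V f);
  sub_id : forall x, sub_ob U x -> sub_mor U (vid V x);
  sub_comp : forall g f, vsrc V g = vtgt V f ->
    sub_mor U g -> sub_mor U f -> sub_mor U (vcomp g f);
  sub_ob_linear : submod_closed (mem (sub_ob U));
  sub_mor_linear : submod_closed (mem (sub_mor U))
}.

Definition proper_subcategory (U : subdata) : Prop :=
  [/\ vector_subcategory U, U <> sub_whole, U <> sub_OV & U <> sub_O].

(* [rho] restricts to a functor on the semidirect product with [U]; all the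
   equations of a twisted representation are inherited by the restriction. *)
Definition rep_restricts (G : categorical_group) (R : twisted_rep G V)
    (U : subdata) : Prop :=
  (forall (g : gOb G) v, sub_ob U v -> sub_ob U (fob (rep_act R) (g, v))) /\
  (forall (k : gMor G) f, sub_mor U f -> sub_mor U (fmor (rep_act R) (k, f))).

Definition reducible (G : categorical_group) (R : twisted_rep G V) : Prop :=
  exists U : subdata, proper_subcategory U /\ rep_restricts R U.

Definition irreducible (G : categorical_group) (R : twisted_rep G V) : Prop :=
  ~ reducible R.
End Subcategories.

Definition zero_functor (K : fieldType) (V W : vector_category K)
    (F : functor V W) : Prop :=
  (forall v, sub_ob (sub_OV W) (fob F v)) /\
  (forall f, sub_mor (sub_OV W) (fmor F f)).

Section Quotient.
Variables (K : fieldType) (V : vector_category K).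

Definition quot_mor := Quotient.quot (hom00 V).
HB.instance Definition _ := GRing.Zmodule.on quot_mor.
HB.instance Definition _ := EqQuotient.on quot_mor.

Definition to_quot (f : vMor V) : quot_mor := \pi_(quot_mor) f.

Lemma to_quotP f g : reflect (to_quot f = to_quot g) (f - g \in hom00 V).
Proof. by rewrite (Quotient.idealrBE (hom00 V)); apply: eqP. Qed.

Lemma to_quotB : {morph to_quot : f g / f - g}.
Proof. by move=> f g; rewrite /to_quot; apply: (raddfB \pi_(Quotient.quot (hom00 V))). Qed.

Lemma to_quotD : {morph to_quot : f g / f + g}.
Proof. by move=> f g; rewrite /to_quot; apply: (raddfD \pi_(Quotient.quot (hom00 V))). Qed.

Lemma repr_to_quot f : repr (to_quot f) - f \in hom00 V.
Proof. by apply/to_quotP; rewrite /to_quot reprK. Qed.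

Lemma repr_quotK (x : quot_mor) : to_quot (repr x) = x.
Proof. exact: reprK. Qed.

Definition quot_scale (a : K) (x : quot_mor) : quot_mor := to_quot (a *: repr x).

Lemma to_quotZ a f : to_quot (a *: f) = quot_scale a (to_quot f).
Proof.
apply/to_quotP; rewrite -scalerBr; apply: hom00Z.
by rewrite -opprB rpredN repr_to_quot.
Qed.

Lemma quot_scaleA a b x : quot_scale a (quot_scale b x) = quot_scale (a * b) x.
Proof. by rewrite -(repr_quotK x) -!to_quotZ scalerA. Qed.

Lemma quot_scale1 : left_id 1 quot_scale.
Proof. by move=> x; rewrite -(repr_quotK x) -!to_quotZ scale1r. Qed.

Lemma quot_scaleDr : right_distributive quot_scale +%R.
Proof.
move=> a x y; rewrite -(repr_quotK x) -(repr_quotK y).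
by rewrite -to_quotD -!to_quotZ scalerDr to_quotD.
Qed.

Lemma quot_scaleDl x : {morph quot_scale^~ x : a b / a + b}.
Proof. by move=> a b; rewrite -(repr_quotK x) -!to_quotZ scalerDl to_quotD. Qed.

HB.instance Definition _ := GRing.Zmodule_isLmodule.Build K quot_mor
  quot_scaleA quot_scale1 quot_scaleDr quot_scaleDl.

Lemma to_quot_is_linear : linear to_quot.
Proof. by move=> a f g; rewrite to_quotD to_quotZ. Qed.

HB.instance Definition _ := GRing.isLinear.Build K (vMor V) quot_mor _ to_quot
  to_quot_is_linear.

Record quotient_well_defined : Prop := QuotientWellDefined {
  src_descends : forall f f', to_quot f = to_quot f' -> vsrc V f = vsrc V f';
  tgt_descends : forall f f', to_quot f = to_quot f' -> vtgt V f = vtgt V f';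
  comp_descends : forall g g' f f',
    vsrc V g = vtgt V f -> vsrc V g' = vtgt V f' ->
    to_quot g = to_quot g' -> to_quot f = to_quot f' ->
    to_quot (vcomp g f) = to_quot (vcomp g' f')
}.

Definition quot_src (x : quot_mor) : vOb V := vsrc V (repr x).
Definition quot_tgt (x : quot_mor) : vOb V := vtgt V (repr x).
Definition quot_id (v : vOb V) : quot_mor := to_quot (vid V v).
Definition quot_comp (y x : quot_mor) : quot_mor :=
  to_quot (vcomp (repr y) (repr x)).

Lemma quot_srcE f : quot_src (to_quot f) = vsrc V f.
Proof.
by apply/eqP; rewrite -subr_eq0 -linearB; case/andP: (repr_to_quot f).
Qed.

Lemma quot_tgtE f : quot_tgt (to_quot f) = vtgt V f.
Proof.
by apply/eqP; rewrite -subr_eq0 -linearB; case/andP: (repr_to_quot f).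
Qed.

Lemma quot_src_is_linear : linear quot_src.
Proof.
move=> a x y; rewrite -(repr_quotK x) -(repr_quotK y).
by rewrite -linearP !quot_srcE linearP.
Qed.

Lemma quot_tgt_is_linear : linear quot_tgt.
Proof.
move=> a x y; rewrite -(repr_quotK x) -(repr_quotK y).
by rewrite -linearP !quot_tgtE linearP.
Qed.

Lemma quot_id_is_linear : linear quot_id.
Proof. by move=> a x y; rewrite /quot_id !linearP. Qed.

HB.instance Definition _ := GRing.isLinear.Build K quot_mor (vOb V) _ quot_src
  quot_src_is_linear.
HB.instance Definition _ := GRing.isLinear.Build K quot_mor (vOb V) _ quot_tgt
  quot_tgt_is_linear.
HB.instance Definition _ := GRing.isLinear.Build K (vOb V) quot_mor _ quot_id
  quot_id_is_linear.

Hypothesis qV : quotient_well_defined.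

Lemma quot_compE g f : vsrc V g = vtgt V f ->
  quot_comp (to_quot g) (to_quot f) = to_quot (vcomp g f).
Proof.
move=> e; apply: (comp_descends qV); rewrite ?repr_quotK //.
by have := quot_srcE g; have := quot_tgtE f; rewrite /quot_src /quot_tgt e => -> ->.
Qed.

Lemma quotientP : category_laws quot_src quot_tgt quot_id quot_comp.
Proof.
have [Vs Vt Vsc Vtc VA Vl Vr] := vcatP V.
split.
- by move=> x; rewrite quot_srcE Vs.
- by move=> x; rewrite quot_tgtE Vt.
- by move=> g f e; rewrite quot_srcE Vsc.
- by move=> g f e; rewrite quot_tgtE Vtc.
- move=> h g f; rewrite -(repr_quotK h) -(repr_quotK g) -(repr_quotK f).
  rewrite !quot_srcE !quot_tgtE => e1 e2.
  by rewrite !quot_compE ?Vsc ?Vtc // VA.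
- move=> f; rewrite -(repr_quotK f) quot_tgtE /quot_id.
  by rewrite quot_compE ?Vs // Vl.
- move=> f; rewrite -(repr_quotK f) quot_srcE /quot_id.
  by rewrite quot_compE ?Vt // Vr.
Qed.

(* The object space Obj / {0} is identified with Obj. *)
Definition quotient_category : vector_category K :=
  @VectorCategory K (vOb V) quot_mor quot_src quot_tgt quot_id quot_comp quotientP.
End Quotient.

Definition induced_functor (K : fieldType) (V W : vector_category K)
    (F : functor V W) (qV : quotient_well_defined V)
    (Fq : functor (quotient_category qV) W) : Prop :=
  (forall v : vOb V, fob Fq v = fob F v) /\
  (forall f : vMor V, fmor Fq (to_quot f) = fmor F f).

Definition iso_on_ob_and_mor (K : fieldType) (V W : vector_category K)
    (F : functor V W) : Prop :=
  [/\ linear_functor F, bijective (fob F) & bijective (fmor F)].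

(* Main.v *)
Require Import Defs.
From mathcomp Require Import all_boot all_algebra.
From mathcomp Require Import boolp classical_sets.

Set Implicit Arguments.
Unset Strict Implicit.
Unset Printing Implicit Defensive.

Import GRing.Theory.
Local Open Scope ring_scope.

(** This is Schur's lemma, except that an irreducible representation on [V] may
    have the invariant subcategory [O_V] besides the classical [O] and [V]; this
    is where the quotient by [Hom(0,0)] comes from.

    The kernel of [F] (objects sent to [0], morphisms sent to [0]) is a vector
    subcategory of [V1] stable under the action, although composition is not
    assumed linear: the identity map is linear, so [0] is the identity of the
    object [0] and a composite of two zero morphisms is zero
    ([kernel_subcategory], [kernel_restricts]).  By irreducibility the kernel is
    [V1], [O_V1] or [O].  In the first case [F] is zero; in the other two [F] is
    injective on objects.

    Injectivity on objects is what makes the image of [F] a subcategory: if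
    [F g] and [F f] are composable, so are [g] and [f], and the composite
    [F g o F f] is [F (g o f)] ([image_subcategory]).  By irreducibility the
    image is [V2], or it lies in [O_V2] and [F] is zero.  So [F] may be assumed
    surjective on objects and on morphisms.

    If the kernel is [O], then [F] is bijective and its inverse is a morphism of
    representations ([bijective_rep_isomorphism]).  If the kernel is [O_V1],
    then two morphisms of [V1] agree modulo [Hom(0,0)] exactly when [F]
    identifies them; this makes composition descend to the quotient, and the
    induced functor is injective ([quotient_of_kernel],
    [induced_functor_iso]). *)

(** * Linear maps given by a property *)

Section LinearMaps.
Variables (K : fieldType) (U V : lmodType K) (f : U -> V).
Hypothesis f_linear : linear f.

Lemma linear_map0 : f 0 = 0.
Proof. by have := f_linear (-1) 0 0; rewrite scaler0 addr0 scaleN1r addNr. Qed.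

Lemma linear_mapB u v : f (u - v) = f u - f v.
Proof. by rewrite addrC -scaleN1r f_linear scaleN1r addrC. Qed.

Lemma ker_submod_closed : submod_closed (mem [set u | f u = 0]%classic).
Proof.
split=> [|a u v]; rewrite !in_setE /=; first exact: linear_map0.
by move=> fu fv; rewrite f_linear fu fv scaler0 addr0.
Qed.

Lemma im_submod_closed : submod_closed (mem (range f)).
Proof.
split=> [|a u v]; rewrite !in_setE; first by exists 0; rewrite ?linear_map0.
by move=> [u' _ <-] [v' _ <-]; exists (a *: u' + v'); rewrite ?f_linear.
Qed.

Lemma linear_map_inj : (forall u, f u = 0 -> u = 0) -> injective f.
Proof.
move=> ker0 u v fuv; apply/eqP; rewrite -subr_eq0; apply/eqP/ker0.
by rewrite linear_mapB fuv subrr.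
Qed.

Lemma linear_map_inverse f' : cancel f f' -> cancel f' f -> linear f'.
Proof.
by move=> fK f'K a u v; rewrite -{1}(f'K u) -{1}(f'K v) -f_linear fK.
Qed.
End LinearMaps.

Lemma surjective_inverse (T S : Type) (f : T -> S) :
  injective f -> range f = setT ->
  exists2 f', cancel f f' & cancel f' f.
Proof.
move=> f_inj f_surj.
have pre y : {x | f x = y}.
  apply: cid; have : range f y by rewrite f_surj.
  by case=> x _ fx; exists x.
exists (fun y => sval (pre y)) => [x|y]; last exact: (svalP (pre y)).
by apply: f_inj; exact: (svalP (pre (f x))).
Qed.

(** * Invariant subcategories of an irreducible representation *)

Lemma irreducible_subcategory (K : fieldType) (G : categorical_group)
    (V : vector_category K) (R : twisted_rep G V) (U : subdata V) :
  irreducible R -> vector_subcategory U -> rep_restricts R U ->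
  [\/ U = sub_whole V, U = sub_OV V | U = sub_O V].
Proof.
move=> R_irr U_sub U_inv.
have [->|nW] := pselect (U = sub_whole V); first exact: Or31.
have [->|nOV] := pselect (U = sub_OV V); first exact: Or32.
have [->|nO] := pselect (U = sub_O V); first exact: Or33.
by case: R_irr; exists U.
Qed.

(** * Kernel and image of a linear functor *)

Section KernelImage.
Variables (K : fieldType) (V W : vector_category K) (F : functor V W).
Hypothesis F_linear : linear_functor F.

Let F_ob_linear : linear (fob F : vOb V -> vOb W) := F_linear.1.
Let F_mor_linear : linear (fmor F : vMor V -> vMor W) := F_linear.2.

Definition kernel : subdata V :=
  @Subdata K V [set v | fob F v = (0 : vOb W)]%classic
    [set f | fmor F f = (0 : vMor W)]%classic.

Definition image : subdata W :=
  @Subdata K W (range (fob F : vOb V -> vOb W))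
    (range (fmor F : vMor V -> vMor W)).

(** Composition is not assumed linear, so [0 o 0 = 0] has to come from [1_0 = 0]. *)
Lemma comp00 : vcomp (0 : vMor W) 0 = 0.
Proof.
have := law_comp_idl (vcatP W) 0.
by rewrite !linear0.
Qed.

Lemma kernel_subcategory : vector_subcategory kernel.
Proof.
split=> /=.
- by move=> f Ff; rewrite -[LHS](functor_src F f) Ff /= linear0.
- by move=> f Ff; rewrite -[LHS](functor_tgt F f) Ff /= linear0.
- by move=> x Fx; rewrite [LHS](functor_id F x) Fx /= linear0.
- by move=> g f gf Fg Ff; rewrite [LHS](functor_comp F gf) Fg Ff /= comp00.
- exact: (ker_submod_closed F_ob_linear).
- exact: (ker_submod_closed F_mor_linear).
Qed.

(** For a functor that identifies objects, [F g] and [F f] may be composable when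
    [g] and [f] are not, and their composite need not be in the image;
    injectivity on objects rules this out. *)
Lemma image_subcategory :
  injective (fob F : vOb V -> vOb W) -> vector_subcategory image.
Proof.
move=> F_inj; split=> /=.
- by move=> _ [f _ <-]; exists (vsrc V f) => //; rewrite -[LHS](functor_src F f).
- by move=> _ [f _ <-]; exists (vtgt V f) => //; rewrite -[LHS](functor_tgt F f).
- by move=> _ [x _ <-]; exists (vid V x) => //; rewrite [LHS](functor_id F x).
- move=> _ _ /[swap] -[g _ <-] /[swap] -[f _ <-] gf.
  have {}gf : vsrc V g = vtgt V f.
    apply: F_inj; rewrite -[LHS](functor_src F g) -[RHS](functor_tgt F f).
    exact: gf.
  by exists (vcomp g f) => //; rewrite [LHS](functor_comp F gf).
- exact: (im_submod_closed F_ob_linear).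
- exact: (im_submod_closed F_mor_linear).
Qed.

Lemma zero_functor_of_kernel : kernel = sub_whole V -> zero_functor F.
Proof.
case=> kob kmor; split=> [v|f] /=.
  by have : [set v | fob F v = (0 : vOb W)]%classic v by rewrite kob.
have -> : fmor F f = (0 : vMor W).
  by have : [set f | fmor F f = (0 : vMor W)]%classic f by rewrite kmor.
exact: rpred0.
Qed.

(** A functor whose objects all go to [0] is zero: its morphisms have source and
    target [0]. *)
Lemma zero_functor_of_image_ob : sub_ob image = [set 0]%classic -> zero_functor F.
Proof.
move=> im0; have F0 (v : vOb V) : fob F v = (0 : vOb W).
  by have : sub_ob image (fob F v) by [exists v]; rewrite im0.
split=> // f /=; rewrite hom00E; apply/andP; split; apply/eqP.
  by rewrite [LHS](functor_src F f) F0.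
by rewrite [LHS](functor_tgt F f) F0.
Qed.

Lemma injective_ob_of_kernel :
  sub_ob kernel = [set 0]%classic -> injective (fob F : vOb V -> vOb W).
Proof.
move=> ker0; apply: (linear_map_inj F_ob_linear) => v Fv.
by have : sub_ob kernel v by []; rewrite ker0.
Qed.

Lemma injective_mor_of_kernel :
  sub_mor kernel = [set vid V 0]%classic ->
  injective (fmor F : vMor V -> vMor W).
Proof.
move=> ker0; apply: (linear_map_inj F_mor_linear) => f Ff.
by have : sub_mor kernel f by []; rewrite ker0 /= linear0.
Qed.

(** When the kernel on morphisms is [Hom(0,0)], the projection to the quotient and
    [F] induce the same equivalence relation, so that every question about
    classes becomes one about the functor [F]. *)
Lemma to_quot_eq_of_kernel (f g : vMor V) :
  sub_mor kernel = [set f | f \in hom00 V]%classic ->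
  to_quot f = to_quot g <-> fmor F f = fmor F g.
Proof.
move=> kerE.
have kerP (h : vMor V) : h \in hom00 V <-> fmor F h = (0 : vMor W).
  by have <- : sub_mor kernel h = (h \in hom00 V) by rewrite kerE.
split.
  move/to_quotP/kerP; rewrite (linear_mapB F_mor_linear) => /eqP.
  by rewrite subr_eq0 => /eqP.
move=> Ffg; apply/to_quotP/kerP.
by rewrite (linear_mapB F_mor_linear) Ffg subrr.
Qed.

(** Composites of congruent morphisms are congruent because congruence is
    equality after applying the functor [F]. *)
Lemma quotient_of_kernel :
  sub_mor kernel = [set f | f \in hom00 V]%classic -> quotient_well_defined V.
Proof.
move=> kerE; split.
- by move=> f f' ff'; rewrite -!quot_srcE ff'.
- by move=> f f' ff'; rewrite -!quot_tgtE ff'.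
- move=> g g' f f' gf gf' /(to_quot_eq_of_kernel _ _ kerE) Fg.
  move=> /(to_quot_eq_of_kernel _ _ kerE) Ff.
  apply/(to_quot_eq_of_kernel _ _ kerE).
  by rewrite [LHS](functor_comp F gf) [RHS](functor_comp F gf') Fg Ff.
Qed.

Lemma induced_functor_iso (qV : quotient_well_defined V) :
  kernel = sub_OV V -> image = sub_whole W ->
  exists Fq : functor (quotient_category qV) W,
    induced_functor F Fq /\ iso_on_ob_and_mor Fq.
Proof.
case=> ker_ob ker_mor [im_ob im_mor].
have F_eq (f g : vMor V) := to_quot_eq_of_kernel f g ker_mor.
pose Fq (x : quot_mor V) : vMor W := fmor F (repr x).
have FqE (f : vMor V) : Fq (to_quot f) = fmor F f.
  by apply/F_eq; rewrite repr_quotK.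
(* The composite of two classes is that of their representatives, so each
   functor law of [Fq] is the law of [F] at representatives. *)
have Fq_src x : vsrc W (Fq x) = fob F (quot_src x)
  by exact: (functor_src F (repr x)).
have Fq_tgt x : vtgt W (Fq x) = fob F (quot_tgt x)
  by exact: (functor_tgt F (repr x)).
have Fq_id x : Fq (quot_id x) = vid W (fob F x).
  by rewrite FqE [LHS](functor_id F x).
have Fq_comp y x : quot_src y = quot_tgt x ->
    Fq (quot_comp y x) = vcomp (Fq y) (Fq x).
  by move=> yx; rewrite FqE [LHS](functor_comp F yx).
exists (@Functor (quotient_category qV) W (fob F) Fq Fq_src Fq_tgt Fq_id Fq_comp).
split; first by split.
have Fq_inj : injective Fq.
  move=> x y; rewrite -(repr_quotK x) -(repr_quotK y) !FqE => Fxy.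
  exact/F_eq.
have Fq_surj : range Fq = setT.
  apply/seteqP; split=> // w _; have : range (fmor F) w by rewrite im_mor.
  by case=> f _ <-; exists (to_quot f).
split.
- split=> [|a x y] /=; first exact: F_ob_linear.
  rewrite -(repr_quotK x) -(repr_quotK y) -linearP !FqE; exact: F_mor_linear.
- have [f' fK f'K] := surjective_inverse (injective_ob_of_kernel ker_ob) im_ob.
  by exists f'.
- by have [f' fK f'K] := surjective_inverse Fq_inj Fq_surj; exists f'.
Qed.
End KernelImage.

(** * Kernel and image of a morphism of representations *)

Section Equivariance.
Variables (K : fieldType) (G : categorical_group) (V1 V2 : vector_category K).
Variables (R1 : twisted_rep G V1) (R2 : twisted_rep G V2) (F : functor V1 V2).
Hypothesis F_morphism : rep_morphism R1 R2 F.

Lemma kernel_restricts : rep_restricts R1 (kernel F).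
Proof.
split=> [g v|k f] /= F0.
  rewrite (rep_morphism_ob F_morphism) F0.
  exact: (linear_map0 (rep_act_obL R2 g)).
rewrite (rep_morphism_mor F_morphism) F0.
exact: (linear_map0 (rep_act_morL R2 k)).
Qed.

Lemma image_restricts : rep_restricts R2 (image F).
Proof.
split=> [g _ [v _ <-]|k _ [f _ <-]] /=.
  exists (fob (rep_act R1) (g, v)) => //; exact: rep_morphism_ob.
exists (fmor (rep_act R1) (k, f)) => //; exact: rep_morphism_mor.
Qed.

(** All laws of the inverse, functorial and equivariant alike, are those of [F]
    read through its injectivity. *)
Lemma bijective_rep_isomorphism :
  linear_functor F ->
  injective (fob F : vOb V1 -> vOb V2) ->
  injective (fmor F : vMor V1 -> vMor V2) ->
  image F = sub_whole V2 -> rep_isomorphism R1 R2 F.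
Proof.
move=> F_linear ob_inj mor_inj [ob_surj mor_surj].
have [o' oK o'K] := surjective_inverse ob_inj ob_surj.
have [m' mK m'K] := surjective_inverse mor_inj mor_surj.
split=> //.
have m'_src f : vsrc V1 (m' f) = o' (vsrc V2 f).
  by apply: ob_inj; rewrite o'K -[LHS](functor_src F (m' f)) m'K.
have m'_tgt f : vtgt V1 (m' f) = o' (vtgt V2 f).
  by apply: ob_inj; rewrite o'K -[LHS](functor_tgt F (m' f)) m'K.
have m'_id x : m' (vid V2 x) = vid V1 (o' x).
  by apply: mor_inj; rewrite m'K [RHS](functor_id F (o' x)) o'K.
have m'_comp g f : vsrc V2 g = vtgt V2 f ->
    m' (vcomp g f) = vcomp (m' g) (m' f).
  move=> gf; have gf' : vsrc V1 (m' g) = vtgt V1 (m' f).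
    by rewrite m'_src m'_tgt gf.
  by apply: mor_inj; rewrite m'K [RHS](functor_comp F gf') !m'K.
exists (@Functor V2 V1 o' m' m'_src m'_tgt m'_id m'_comp); split=> //=.
- split=> [k f|g v|k f] /=.
  + by rewrite -(rep_morphism_eta F_morphism) m'K.
  + by apply: ob_inj; rewrite o'K (rep_morphism_ob F_morphism) o'K.
  + by apply: mor_inj; rewrite m'K (rep_morphism_mor F_morphism) m'K.
- split; first exact: (linear_map_inverse F_linear.1 oK o'K).
  exact: (linear_map_inverse F_linear.2 mK m'K).
Qed.
End Equivariance.

(** * Schur's lemma *)

Theorem theorem8p1 (K : fieldType) (G : categorical_group)
    (V1 V2 : vector_category K)
    (R1 : twisted_rep G V1) (R2 : twisted_rep G V2)
    (R1_irr : irreducible R1) (R2_irr : irreducible R2)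
    (F : functor V1 V2)
    (F_morphism : rep_morphism R1 R2 F) (F_linear : linear_functor F) :
  zero_functor F
  \/ (exists (qV1 : quotient_well_defined V1)
             (Fq : functor (quotient_category qV1) V2),
        induced_functor F Fq /\ iso_on_ob_and_mor Fq)
  \/ rep_isomorphism R1 R2 F.
Proof.
have image_cases : injective (fob F : vOb V1 -> vOb V2) ->
    zero_functor F \/ image F = sub_whole V2.
  move=> ob_inj; have im_sub := image_subcategory F_linear ob_inj.
  have [imE|imE|imE] :=
    irreducible_subcategory R2_irr im_sub (image_restricts F_morphism).
  - by right.
  - by left; apply: zero_functor_of_image_ob; rewrite imE.
  - by left; apply: zero_functor_of_image_ob; rewrite imE.
have [kerE|kerE|kerE] := irreducible_subcategory R1_irr
    (kernel_subcategory F_linear) (kernel_restricts F_morphism).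
- by left; apply: zero_functor_of_kernel.
- have ker_ob : sub_ob (kernel F) = [set 0]%classic by rewrite kerE.
  have ker_mor : sub_mor (kernel F) = [set f | f \in hom00 V1]%classic.
    by rewrite kerE.
  have [F0|imE] := image_cases (injective_ob_of_kernel F_linear ker_ob).
    by left.
  right; left; exists (quotient_of_kernel F_linear ker_mor).
  exact: induced_functor_iso.
- have ker_ob : sub_ob (kernel F) = [set 0]%classic by rewrite kerE.
  have ker_mor : sub_mor (kernel F) = [set vid V1 0]%classic by rewrite kerE.
  have ob_inj := injective_ob_of_kernel F_linear ker_ob.
  have [F0|imE] := image_cases ob_inj; first by left.
  right; right; apply: bijective_rep_isomorphism => //.
  exact: injective_mor_of_kernel.
Qed.
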